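(* Let $(X,\mathcal{F})$ be a set system. Then the following are equivalent. 1. $(X,\mathcal{F})$ is a well-graded family with VC-dimension at most $1$. 2. $(X,\mathcal{F})$ is extremal with VC-dimension at most $1$. 3. The graph $G_{\mathcal{F}}$ is connected and $|ess_{\mathcal{F}}(X)|+1=|\mathcal{F}|=|E(G_{\mathcal{F}})|+1$. 4. $(X,\mathcal{F})$ is well-graded and $|\mathcal{F}|=|E(G_{\mathcal{F}})|+1$. 5. $(X,\mathcal{F})$ is well-graded with additionality $1$ (or equivalently, it is well-graded and $|ess_{\mathcal{F}}(X)|+1=|\mathcal{F}|$). 6. The graph $G_{\mathcal{F}}$ is a tree and all labels on its edges are different. 7. The graph $G_{\mathcal{F}}$ is a tree with $|ess_{\mathcal{F}}(X)|+1$ vertices and $|ess_{\mathcal{F}}(X)|$ edges, where the labels of edges are elements of $ess_{\mathcal{F}}(X)$ and each one is used once. 8. For every $A\in\mathcal{F}$, setting $\mathcal{F}'=flip(\mathcal{F},A\rightarrow\emptyset)$, the graph $G_{\mathcal{F}'}$ is a uniformly directed rooted tree with root $v_\emptyset$ and distinct labels on the edges. 9. For some $A\in\mathcal{F}$, setting $\mathcal{F}'=flip(\mathcal{F},A\rightarrow\emptyset)$, the graph $G_{\mathcal{F}'}$ is a uniformly directed rooted tree with root $v_\emptyset$ and distinct labels on the edges.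
   Context: A set system $(X,\mathcal{F})$ is a finite set $X$ together with a nonempty family $\mathcal{F}$ of distinct subsets of $X$. Its one-inclusion graph $G_{\mathcal{F}}$ is the edge-labelled directed graph with one vertex $v_A$ for each $A\in\mathcal{F}$ and a directed edge from $v_A$ to $v_B$ with label $b$ whenever $B=A\cup\{b\}$ for some $b\in X\setminus A$; $E(G_{\mathcal{F}})$ is its edge set. For directed graphs, connectedness, being a tree, and distances refer to the underlying undirected graph (the distance is infinite if there is no path). The system is well-graded if $|A\triangle B|=d_{G_{\mathcal{F}}}(v_A,v_B)$ for all $A,B\in\mathcal{F}$. $x\in X$ is essential if there are $A,B\in\mathcal{F}$ with $x\in A$, $x\notin B$; $ess_{\mathcal{F}}(X)$ is the set of essential elements. The additionality is $|\mathcal{F}|-|ess_{\mathcal{F}}(X)|$. $Y\subseteq X$ is shattered by $\mathcal{F}$ if $\{A\cap Y:A\in\mathcal{F}\}$ is the full power set of $Y$; the VC-dimension is the largest size of a shattered set. $Y$ is strongly shattered by $\mathcal{F}$ if there is $T\subseteq X\setminus Y$ with $\{Z\cup T:Z\subseteq Y\}\subseteq\mathcal{F}$. The system is extremal if every shattered set is strongly shattered (equivalently, the two collections of sets coincide). For $A\in\mathcal{F}$, $flip(\mathcal{F},A\rightarrow\emptyset)$ is the system on $X$ obtained by applying to $\mathcal{F}$ the bit-flip operation on $a$ for every $a\in A$, where bit-flip on $a$ replaces each member $C$ by $C\setminus\{a\}$ if $a\in C$ and by $C\cup\{a\}$ if $a\notin C$; i.e. it equals $\{C\triangle A:C\in\mathcal{F}\}$.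 A directed rooted tree is uniformly directed if every edge is directed from its endpoint closer to the root to its other endpoint. *)

(* Defs.v *)
From mathcomp Require Import all_boot ssralg ssrint.

Set Implicit Arguments.
Unset Strict Implicit.
Unset Printing Implicit Defensive.

(* An edge [(u, v, l)] goes from [u] to [v] and is labelled [l].              *)
Record ldigraph (V L : finType) := LDigraph {
  vertices : {set V};
  edges : {set V * V * L}
}.

Section LabelledDigraph.

Variables V L : finType.
Implicit Types (G : ldigraph V L) (u v r : V).

Definition elabel (e : V * V * L) : L := e.2.

(* The underlying undirected graph is taken to be simple.  Nothing is lost    *)
(* for one-inclusion graphs: two of their vertices are joined by at most one  *)
(* edge, in at most one direction.                                            *)
Definition adj G : rel V :=
  fun u v => [exists l, ((u, v, l) \in edges G) || ((v, u, l) \in edges G)].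

Definition connected G : Prop :=
  {in vertices G &, forall u v, connect (adj G) u v}.

(* A closed walk of length 2 is not a cycle, hence the bound on the size.     *)
Definition acyclic G : Prop :=
  forall c : seq V, 2 < size c -> ~~ ucycleb (adj G) c.

Definition is_tree G : Prop := connected G /\ acyclic G.

Definition walk G u v (k : nat) : bool :=
  [exists p : k.-tuple V, path (adj G) u p && (last u p == v)].

Lemma connect_walk G u v : connect (adj G) u v -> exists k, walk G u v k.
Proof.
case/connectP=> p pP ->; exists (size p).
by apply/existsP; exists (in_tuple p); rewrite pP /=.
Qed.

(* [None] is the infinite distance.                                           *)
Definition dist G u v : option nat :=
  if decP (@idP (connect (adj G) u v)) is left uv
  then Some (ex_minn (connect_walk uv)) else None.

Lemma dist_SomeP G u v k :
  dist G u v = Some k <->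
    walk G u v k /\ (forall j, walk G u v j -> k <= j).
Proof.
rewrite /dist; case: decP => [uv|nuv].
  case: ex_minnP => m wm min_m; split=> [[<-] //|[wk min_k]].
  by congr Some; apply/eqP; rewrite eqn_leq min_m ?min_k.
split=> // -[/existsP[p /andP[pP /eqP lp]] _]; case: nuv.
by apply/connectP; exists p.
Qed.

Definition uniformly_directed_tree G r : Prop :=
  [/\ is_tree G, r \in vertices G
    & forall u v l, (u, v, l) \in edges G ->
      exists m n, [/\ dist G r u = Some m, dist G r v = Some n & m < n]].

Definition distinct_labels G : Prop := {in edges G &, injective elabel}.

End LabelledDigraph.

Section SetSystem.

Variable X : finType.
Implicit Types (F : {set {set X}}) (A B C Y Z S : {set X}) (a x : X).

Definition symdiff A B : {set X} := (A :\: B) :|: (B :\: A).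

Definition one_inclusion F : ldigraph {set X} X :=
  LDigraph F
    [set e : {set X} * {set X} * X |
      let: (A, B, b) := e in
      [&& A \in F, B \in F, b \notin A & B == b |: A]].

Definition well_graded F : Prop :=
  forall A B, A \in F -> B \in F ->
    dist (one_inclusion F) A B = Some #|symdiff A B|.

Definition ess F : {set X} :=
  [set x | [exists A in F, exists B in F, (x \in A) && (x \notin B)]].

(* Integer-valued, since a family can have fewer members than essential       *)
(* elements.                                                                  *)
Definition additionality F : int := (#|F|%:Z - #|ess F|%:Z)%R.

Definition shattered F Y : bool := [set A :&: Y | A in F] == powerset Y.

Definition strongly_shattered F Y : bool :=
  [exists S : {set X},
    (S \subset ~: Y) && ([set Z :|: S | Z in powerset Y] \subset F)].

Definition vc_dim F : nat := \max_(Y : {set X} | shattered F Y) #|Y|.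

Definition extremal F : Prop :=
  forall Y, shattered F Y -> strongly_shattered F Y.

Definition bit_flip a F : {set {set X}} :=
  [set (if a \in C then C :\ a else a |: C) | C : {set X} in F].

Definition flip F A : {set {set X}} := foldr bit_flip F (enum A).

Lemma flipE F A : flip F A = [set symdiff C A | C in F].
Proof.
rewrite /flip -[in RHS](set_enum A).
elim: (enum A) (enum_uniq A) => [_|a s IHs /= /andP[a_s s_uniq]].
  have sd0 C : symdiff C [set:: [::]] = C.
    by apply/setP=> x; rewrite !inE; case: (x \in C).
  by rewrite (eq_imset _ sd0) imset_id.
rewrite IHs // /bit_flip -imset_comp; apply: eq_imset => C /=.
apply/setP=> x; rewrite !inE (negbTE a_s) andbF orbF /=.
have [->|x_a] := eqVneq x a; case: ifP => aC.
- by rewrite !inE eqxx.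
- by rewrite !inE eqxx.
- by rewrite !inE x_a.
by rewrite !inE (negbTE x_a).
Qed.

End SetSystem.

(* Main.v *)
Require Import Defs.
From mathcomp Require Import all_boot ssralg ssrint.

Set Implicit Arguments.
Unset Strict Implicit.
Unset Printing Implicit Defensive.

(* Write toggle x S for the symmetric difference of S and {x}.  Every condition is
   equivalent to the conjunction of
   - steppable: for distinct A, B in F some x in symdiff A B has toggle x A in F
     (this is well-gradedness);
   - one_edge_per_label: no two edges of the graph carry the same label.
   The cardinality conditions come from a count: for a fixed A in F, the number of
   edges is the sum over B in F of the number of ways to step from B towards A.
   In a steppable family this number is positive for B != A, and it is always 1
   exactly when labels are not repeated.  Two edges with the same label span a
   shattered pair; conversely, stepping inside a shattered pair {x, y} gives two
   edges labelled x, one in each class of members determined by y. *)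

Section OneInclusion.

Variable X : finType.
Implicit Types (F : {set {set X}}) (A B C S T : {set X}) (x y z : X).

(** * Symmetric differences and toggles *)

Lemma in_symdiff A B x : (x \in symdiff A B) = (x \in A) (+) (x \in B).
Proof. by rewrite !inE; case: (x \in A); case: (x \in B). Qed.

Definition toggle x S := [set y | (y \in S) (+) (y == x)].

Lemma in_toggle x S y : (y \in toggle x S) = (y \in S) (+) (y == x).
Proof. by rewrite in_set. Qed.

Lemma toggleK x : involutive (toggle x).
Proof. by move=> S; apply/setP=> y; rewrite !in_toggle addbK. Qed.

Lemma toggle_add x S : x \notin S -> toggle x S = x |: S.
Proof.
move=> xS; apply/setP=> y; rewrite in_toggle !inE.
by have [->|_] := eqVneq y x; rewrite ?addbF // (negbTE xS).
Qed.

Lemma symdiffC A B : symdiff A B = symdiff B A.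
Proof. by apply/setP=> x; rewrite !in_symdiff addbC. Qed.

Lemma symdiffK A : involutive (fun B => symdiff B A).
Proof. by move=> B; apply/setP=> x; rewrite !in_symdiff addbK. Qed.

Lemma symdiff_eq0 A B : (symdiff A B == set0) = (A == B).
Proof.
apply/eqP/eqP=> [/setP AB|->]; apply/setP=> x; last first.
  by rewrite in_symdiff addbb inE.
by move: (AB x); rewrite in_symdiff inE; case: (x \in A); case: (x \in B).
Qed.

Lemma symdiff_toggle_setD1 x A B :
  x \in symdiff A B -> symdiff (toggle x A) B = symdiff A B :\ x.
Proof.
move=> xAB; apply/setP=> y; rewrite in_symdiff in_toggle in_setD1 in_symdiff.
have [->|_] := eqVneq y x; last by rewrite addbF.
by move: xAB; rewrite in_symdiff; case: (x \in A); case: (x \in B).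
Qed.

Lemma card_symdiff_toggle x A B :
  x \in symdiff A B -> #|symdiff A B| = #|symdiff (toggle x A) B|.+1.
Proof. by move=> xAB; rewrite symdiff_toggle_setD1 // (cardsD1 x) xAB. Qed.

Lemma card_symdiff_toggleN x A B :
  x \notin symdiff A B -> #|symdiff (toggle x A) B| = #|symdiff A B|.+1.
Proof.
move=> xAB; rewrite (@card_symdiff_toggle x) ?toggleK //.
by rewrite in_symdiff in_toggle eqxx addbT addNb -in_symdiff.
Qed.

(** * Edges, adjacency and paths *)

Lemma edgesE F S T x :
  ((S, T, x) \in edges (one_inclusion F)) =
  [&& S \in F, T \in F, x \notin S & T == x |: S].
Proof. by rewrite inE. Qed.

Lemma toggle_edge F S x : x \notin S -> S \in F -> toggle x S \in F ->
  (S, toggle x S, x) \in edges (one_inclusion F).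
Proof. by move=> xS SF TF; rewrite edgesE SF TF xS toggle_add /=. Qed.

Lemma toggle_edgeV F S x : x \in S -> S \in F -> toggle x S \in F ->
  (toggle x S, S, x) \in edges (one_inclusion F).
Proof.
move=> xS SF TF; rewrite -{2}(toggleK x S) toggle_edge ?toggleK //.
by rewrite in_toggle xS eqxx.
Qed.

Lemma adjP F A B :
  reflect [/\ A \in F, B \in F & exists x, B = toggle x A]
          (adj (one_inclusion F) A B).
Proof.
apply: (iffP existsP) => [[x]|[AF BF [x eB]]].
  rewrite !edgesE => /orP[]/and4P[? ? xS /eqP e]; subst; split=> //; exists x.
    by rewrite toggle_add.
  by rewrite -toggle_add // toggleK.
exists x; rewrite eB in BF *; have [xA|xA] := boolP (x \in A).
  by rewrite orbC toggle_edgeV.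
by rewrite toggle_edge.
Qed.

Lemma path_in F A p B :
  A \in F -> path (adj (one_inclusion F)) A p -> B \in A :: p -> B \in F.
Proof.
elim: p A => [|C p IHp] A AF /=; first by rewrite inE => _ /eqP->.
case/andP=> /adjP[_ CF _] pP; rewrite inE => /orP[/eqP-> //|].
exact: IHp pP.
Qed.

(** Only a step labelled [x] changes membership of [x], so a path whose ends differ at [x] contains
    both ends of such a step. *)
Lemma path_crossing F A p x :
    path (adj (one_inclusion F)) A p -> x \in symdiff A (last A p) ->
  exists2 S, S \in A :: p & toggle x S \in A :: p.
Proof.
elim: p A => [|B p IHp] A /=; first by rewrite in_symdiff addbb.
case/andP=> /adjP[_ _ [y eB]] pP xA.
have [exy|nxy] := eqVneq x y.
  by exists A; rewrite ?exy -?eB !inE eqxx ?orbT.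
have [|S SB TB] := IHp B pP; last by exists S; rewrite inE ?SB ?TB orbT.
by move: xA; rewrite !in_symdiff eB in_toggle (negbTE nxy) addbF.
Qed.

(** One step changes the size of the symmetric difference with the last vertex by exactly one. *)
Lemma path_symdiff F A p :
  path (adj (one_inclusion F)) A p -> #|symdiff A (last A p)| <= size p.
Proof.
elim: p A => [|B p IHp] A /=.
  by move=> _; rewrite leqn0 cards_eq0 symdiff_eq0.
case/andP=> /adjP[_ _ [y ->]] /IHp; set C := last _ _ => le_p.
have [yA|yA] := boolP (y \in symdiff A C).
  by rewrite (card_symdiff_toggle yA).
by rewrite ltnW // -(card_symdiff_toggleN yA) (leq_trans le_p).
Qed.

(** * Stepping, distances and edge labels *)

Definition steppable F := {in F &, forall A B, A != B ->
  exists2 x, x \in symdiff A B & toggle x A \in F}.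

(** An edge labelled [x] is given by either endpoint; agreement at [x] makes [S] and [T]
    corresponding endpoints, which avoids fixing an orientation. *)
Definition one_edge_per_label F := forall x S T,
  S \in F -> toggle x S \in F -> T \in F -> toggle x T \in F ->
  (x \in S) = (x \in T) -> S = T.

Lemma dist_symdiffP F A B :
  dist (one_inclusion F) A B = Some #|symdiff A B| <->
  walk (one_inclusion F) A B #|symdiff A B|.
Proof.
split=> [/dist_SomeP[] //|w]; apply/dist_SomeP; split=> // j /existsP[p /andP[/path_symdiff + /eqP <-]].
by rewrite size_tuple.
Qed.

(** The first step of a shortest path must lead closer to [B], or the rest would be too short for
    [path_symdiff]. Conversely, repeated steps towards [B] form a walk of the required length. *)
Lemma well_gradedP F : well_graded F <-> steppable F.
Proof.
split=> [wF A B AF BF|sF A B AF BF].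
  rewrite -symdiff_eq0 -cards_eq0 => AB_neq0.
  have /dist_symdiffP/existsP[[p sz_p] /andP[/= pP /eqP lp]] := wF A B AF BF.
  case: p sz_p pP lp => [|C p] /= sz_p; first by rewrite -(eqP sz_p) in AB_neq0.
  case/andP=> /adjP[_ CF [x eC]] pP lp; exists x; last by rewrite -eC.
  apply: contraLR (path_symdiff pP) => /card_symdiff_toggleN.
  by rewrite lp eC -(eqP sz_p) => ->; rewrite -ltnNge /= ltnS leqnSn.
apply/dist_symdiffP; move: {2}#|_| (erefl #|symdiff A B|) => n.
elim: n A AF => [|n IHn] A AF szAB.
  move/eqP: (szAB); rewrite cards_eq0 symdiff_eq0 => /eqP eAB.
  by rewrite szAB; apply/existsP; exists [tuple]; rewrite eAB /=.
have [|x xAB TF] := sF A B AF BF; first by rewrite -symdiff_eq0 -cards_eq0 szAB.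
move: (szAB); rewrite (card_symdiff_toggle xAB) => -[szTB].
have /existsP[p /andP[pP lp]] := IHn _ TF szTB.
apply/existsP; exists [tuple of toggle x A :: p]; rewrite /= pP lp !andbT.
by apply/adjP; split=> //; exists x.
Qed.

Lemma distinct_labelsP F :
  distinct_labels (one_inclusion F) <-> one_edge_per_label F.
Proof.
split=> [dF|dF].
  have dN x S T : S \in F -> toggle x S \in F -> T \in F -> toggle x T \in F ->
      x \notin S -> x \notin T -> S = T.
    move=> SF S'F TF T'F xS xT.
    by have /(_ erefl)[] := dF _ _ (toggle_edge xS SF S'F) (toggle_edge xT TF T'F).
  move=> x S T SF S'F TF T'F exST; have [xS|xS] := boolP (x \in S); last first.
    by apply: (dN x) => //; rewrite -exST.
  apply: (can_inj (toggleK x)); apply: (dN x); rewrite ?toggleK //.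
    by rewrite in_toggle eqxx xS.
  by rewrite in_toggle eqxx -exST xS.
move=> [[S S'] x] [[T T'] y]; rewrite !edgesE /elabel /=.
case/and4P=> SF S'F xS /eqP eS' /and4P[TF T'F yT /eqP eT'] exy.
rewrite {}exy {x} in xS eS' *; rewrite {}eS' {}eT' in S'F T'F *.
rewrite (dF y S T) ?toggle_add //.
by rewrite (negbTE xS) (negbTE yT).
Qed.

Lemma well_graded_connected F : well_graded F -> connected (one_inclusion F).
Proof.
move=> wF A B AF BF; have /dist_symdiffP/existsP[p /andP[pP /eqP lp]] := wF A B AF BF.
by apply/connectP; exists p.
Qed.

(** On a path without repetition, the first label [x] separates [A] from [B]: otherwise a later step
    toggles [x] back, it uses the same edge as the first one, and the path revisits [A]. *)
Lemma connected_steppable F :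
  connected (one_inclusion F) -> one_edge_per_label F -> steppable F.
Proof.
move=> cF dF A B AF BF; have /connectP[p0 pP0 ->] := cF A B AF BF.
case/shortenP: pP0 => -[|C p] /= pP; first by rewrite eqxx.
case/andP=> Ap _ _ _; case/andP: pP => /adjP[_ CF [x eC]] pP.
exists x; last by rewrite -eC.
apply: contraR Ap => xAB.
have [|S Sp Tp] := path_crossing pP (x := x).
  by rewrite eC in xAB *; rewrite in_symdiff in_toggle eqxx addbT addNb -in_symdiff.
have SF := path_in CF pP Sp; have TF := path_in CF pP Tp.
rewrite eC in CF.
have [exAS|exAS] := eqVneq (x \in A) (x \in S).
  by rewrite (dF x A S).
rewrite (dF x A (toggle x S)) ?toggleK // in_toggle eqxx.
by move: exAS; case: (x \in A); case: (x \in S).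
Qed.

(* In a cycle C, toggle x C, ..., T, C the segment from toggle x C to T avoids C,
   hence uses no edge labelled x; so T and toggle x C agree at x, which forces
   T = toggle x C. *)
Lemma one_edge_per_label_acyclic F :
  one_edge_per_label F -> acyclic (one_inclusion F).
Proof.
move=> dF [|C [|D [|E p]]] //= _; apply/negP; rewrite /ucycleb /=.
rewrite rcons_path -!andbA; set q := E :: p.
case/and5P=> /adjP[CF DF [x eD]] DE pP /adjP[_ _ [z eC]] /andP[Cq /andP[Dq _]].
have {DE}pP : path (adj (one_inclusion F)) D q by rewrite /= DE.
set T := last E p in eC; have lq : last D q = T by [].
have Tq : T \in q by rewrite /T mem_last.
have [xDT|xDT] := boolP (x \in symdiff D T).
  have [S Sq S'q] := path_crossing pP xDT.
  have SF := path_in DF pP Sq; have S'F := path_in DF pP S'q.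
  rewrite eD in DF; case/negP: Cq.
  have [exCS|exCS] := eqVneq (x \in C) (x \in S).
    by rewrite (dF x C S).
  rewrite (dF x C (toggle x S)) ?toggleK // in_toggle eqxx.
  by move: exCS; case: (x \in C); case: (x \in S).
case/negP: Dq; rewrite -/q; suff -> : D = T by [].
move: xDT; rewrite in_symdiff eD eC !in_toggle eqxx.
have [->|_] := eqVneq x z; first by rewrite toggleK.
by rewrite addbF; case: (x \in T).
Qed.

(** Walk from [A] towards [B] and stop just before [x] is toggled. Such steps toggle only elements
    of [symdiff A B]. *)
Lemma steppable_between F A B x :
    steppable F -> A \in F -> B \in F -> x \in symdiff A B ->
  exists S, [/\ S \in F, toggle x S \in F, (x \in S) = (x \in A)
              & forall y, y \notin symdiff A B -> (y \in S) = (y \in A)].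
Proof.
move=> sF; move: {2}#|_| (leqnn #|symdiff A B|) => n.
elim: n A => [|n IHn] A szAB AF BF xAB.
  by move: szAB; rewrite leqn0 cards_eq0 => /eqP AB0; rewrite AB0 inE in xAB.
have [|y yAB TF] := sF A B AF BF.
  by rewrite -symdiff_eq0; apply/set0Pn; exists x.
have [exy|nxy] := eqVneq x y; first by exists A; rewrite exy.
have [||S [SF S'F xS agreeS]] := IHn (toggle y A) _ TF BF.
- by rewrite -ltnS -card_symdiff_toggle.
- by rewrite symdiff_toggle_setD1 // in_setD1 nxy.
exists S; split=> // [|z zAB]; first by rewrite xS in_toggle (negbTE nxy) addbF.
have nzy : z != y by apply: contraNneq zAB => ->.
rewrite agreeS; first by rewrite in_toggle (negbTE nzy) addbF.
by rewrite symdiff_toggle_setD1 // in_setD1 negb_and zAB orbT.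
Qed.

(** * Essential elements as edge labels *)

Lemma essP F x :
  reflect (exists A B, [/\ A \in F, B \in F & x \in symdiff A B]) (x \in ess F).
Proof.
rewrite inE; apply: (iffP exists_inP) => [[A AF /exists_inP[B BF /andP[xA xB]]]|].
  by exists A, B; split=> //; rewrite in_symdiff xA (negbTE xB).
case=> A [B [AF BF]]; rewrite in_symdiff.
have [xA xB|xA xB] := boolP (x \in A).
  by exists A => //; apply/exists_inP; exists B; rewrite ?xA.
by exists B => //; apply/exists_inP; exists A; rewrite // andbC xA.
Qed.

Lemma elabel_ess F : {in edges (one_inclusion F), forall e, elabel e \in ess F}.
Proof.
move=> [[S T] x]; rewrite edgesE => /and4P[SF TF xS /eqP eT]; apply/essP.
exists S, T; split=> //.
by rewrite in_symdiff eT !inE eqxx (negbTE xS).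
Qed.

Lemma elabel_edges F : connected (one_inclusion F) ->
  [set elabel e | e in edges (one_inclusion F)] = ess F.
Proof.
move=> cF; apply/setP=> x; apply/imsetP/essP => [[e eE ->]|[A [B [AF BF xAB]]]].
  exact/essP/elabel_ess.
have /connectP[p pP eB] := cF A B AF BF; rewrite {}eB in xAB.
have [S Sp Tp] := path_crossing pP xAB.
have SF := path_in AF pP Sp; have TF := path_in AF pP Tp.
have [xS|xS] := boolP (x \in S); last first.
  by exists (S, toggle x S, x) => //; apply: toggle_edge.
by exists (toggle x S, S, x) => //; apply: toggle_edgeV.
Qed.

(** * Counting edges by descents *)

Definition descents F A B := [set x in symdiff A B | toggle x B \in F].

Lemma in_descents F A B x :
  (x \in descents F A B) = (x \in symdiff A B) && (toggle x B \in F).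
Proof. by rewrite in_set. Qed.

Lemma descents_self F A : descents F A A = set0.
Proof. by apply/setP=> x; rewrite in_descents in_symdiff addbb in_set0. Qed.

Lemma descents_gt0 F A B : steppable F -> A \in F -> B \in F -> A != B ->
  0 < #|descents F A B|.
Proof.
move=> sF AF BF nAB; have [|x xBA TF] := sF B A BF AF; first by rewrite eq_sym.
by apply/card_gt0P; exists x; rewrite in_descents symdiffC xBA.
Qed.

(* Each edge is a descent, with respect to any base set A, of exactly one of
   its endpoints. *)
Lemma card_edges F A :
  #|edges (one_inclusion F)| = \sum_(B in F) #|descents F A B|.
Proof.
pose P := [set u : {set X} * X | (u.1 \in F) && (u.2 \in descents F A u.1)].
have PE B x : ((B, x) \in P) = [&& B \in F, x \in symdiff A B & toggle x B \in F].
  by rewrite in_set in_descents.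
transitivity #|P|; last first.
  rewrite -sum1_card (eq_bigr (fun B => \sum_(x in descents F A B) 1)); last first.
    by move=> B _; rewrite sum1_card.
  by rewrite pair_big_dep; apply: eq_bigl => -[B x]; rewrite inE.
pose g (u : {set X} * X) := if u.2 \in u.1 then (toggle u.2 u.1, u.1, u.2)
                            else (u.1, toggle u.2 u.1, u.2).
rewrite -(@card_in_imset _ _ g P).
  congr #|pred_of_set _|; apply/setP=> -[[S T] x]; apply/idP/imsetP => [|[[B y]]].
    rewrite edgesE => /and4P[SF TF xS /eqP eT]; rewrite -toggle_add // in eT.
    have xT : x \in T by rewrite eT in_toggle eqxx addbT.
    have [xAS|xAS] := boolP (x \in symdiff A S).
      by exists (S, x); [rewrite PE SF xAS -eT|
                         rewrite /g /= (negbTE xS) eT].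
    exists (T, x); last by rewrite /g /= xT eT toggleK.
    rewrite PE TF eT toggleK SF andbT.
    by move: xAS; rewrite !in_symdiff in_toggle eqxx addbT addbN.
  rewrite PE => /and3P[BF yAB T'F]; rewrite /g /=.
  case: ifP => yB [-> -> ->]; last by rewrite toggle_edge ?yB.
  by rewrite toggle_edgeV.
move=> [B x] [C y]; rewrite !PE !in_symdiff.
case/and3P=> BF xAB TF /and3P[CF yAC T'F]; rewrite /g /=.
case: ifP => xB; case: ifP => yC [] eB eC exy; subst y.
- by rewrite eC.
- by move: xAB yAC; rewrite xB yC; case: (x \in A).
- by move: xAB yAC; rewrite xB yC; case: (x \in A).
by rewrite eB.
Qed.

Lemma sum_gt0_eq1 (I : finType) (D : {set I}) (f : I -> nat) :
    (forall i, i \in D -> 0 < f i) -> \sum_(i in D) f i = #|D| ->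
  {in D, forall i, f i = 1}.
Proof.
move=> f_gt0 sumf i iD.
have: \sum_(j in D) 1 == \sum_(j in D) f j by rewrite sum1_card sumf.
have [_ ->] := @leqif_sum _ (mem D) (fun j => 1 == f j) (fun => 1) f
                 (fun j jD => leqif_eq (f_gt0 j jD)).
by move=> /forall_inP/(_ i iD)/eqP.
Qed.

Lemma card_edges_setD1 F A :
  #|edges (one_inclusion F)| = \sum_(B in F :\ A) #|descents F A B|.
Proof.
rewrite (card_edges F A) (bigID (pred1 A)) /= big1 ?add0n.
  by apply: eq_bigl => B; rewrite in_setD1 andbC.
by move=> B /andP[_ /eqP->]; rewrite descents_self cards0.
Qed.

(** It suffices that each member other than [A] has a single descent. Two descents [y] and [z] from
    [B] give two edges labelled [y]: one at [B], and one met between [toggle z B] and [A], whose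
    ends agree with [A] at [z] while [B] does not. *)
Lemma one_edge_per_label_card F : F != set0 ->
  steppable F -> one_edge_per_label F -> #|F| = #|edges (one_inclusion F)| + 1.
Proof.
case/set0Pn=> A AF sF dF.
rewrite (card_edges_setD1 F A) (cardsD1 A) AF addnC -sum1_card; congr (_ + _).
apply: eq_bigr => B; rewrite in_setD1 => /andP[nBA BF].
apply/eqP; rewrite eq_sym eqn_leq descents_gt0 // 1?eq_sym // andbT.
apply/card_le1_eqP => y z; rewrite !in_descents.
case/andP=> yAB yF /andP[zAB zF].
apply/eqP/negPn/negP; rewrite eq_sym => nyz.
have yAT : y \in symdiff (toggle z B) A.
  by move: yAB; rewrite !in_symdiff in_toggle (negbTE nyz) addbF addbC.
have [S [SF S'F yS agreeS]] := steppable_between sF zF AF yAT.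
have eSB : S = B.
  apply: (dF y) => //.
  by rewrite yS in_toggle (negbTE nyz) addbF.
have := agreeS z; rewrite eSB !in_symdiff in_toggle eqxx addbT.
move: zAB; rewrite in_symdiff.
by case: (z \in A); case: (z \in B) => // _ /(_ isT).
Qed.

(** Counting from the base [S] leaves each other member exactly one descent. If [S] and [T] were
    distinct, [toggle x T] would have two: [x], leading to [T], and a step [y] towards
    [toggle x S]. *)
Lemma card_one_edge_per_label F :
  steppable F -> #|F| = #|edges (one_inclusion F)| + 1 -> one_edge_per_label F.
Proof.
move=> sF cardF x S T SF S'F TF T'F exST; apply/eqP/negPn/negP=> nST.
have eqx : x \notin symdiff S T by rewrite in_symdiff exST addbb.
have nST' : toggle x T != S.
  by apply: contra_eqN exST => /eqP <-; rewrite in_toggle eqxx addbT; case: (x \in T).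
have card1 : {in F :\ S, forall B, #|descents F S B| = 1}.
  apply: sum_gt0_eq1 => [B|].
    by rewrite in_setD1 => /andP[nBS BF]; apply: descents_gt0; rewrite 1?eq_sym.
  rewrite -card_edges_setD1; apply/eqP; rewrite -(eqn_add2r 1) -cardF.
  by rewrite (cardsD1 S) SF addnC.
have [|y yST yF] := sF (toggle x T) (toggle x S) T'F S'F.
  by rewrite (can_eq (toggleK x)) eq_sym.
have{} yST : y \in symdiff S T.
  by move: yST; rewrite !in_symdiff !in_toggle; do !case: (_ \in _); case: (y == x).
have nyx : y != x by apply: contraNneq eqx => <-.
have /eqP/cards1P[w /setP dw] : #|descents F S (toggle x T)| = 1.
  by apply: card1; rewrite in_setD1 nST'.
move: (dw y) (dw x).
rewrite !in_set1 !in_descents !in_symdiff !in_toggle toggleK TF yF.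
rewrite eqxx exST (negbTE nyx) addbT !andbT addbN addbb addbF -in_symdiff yST.
by move=> /esym/eqP yw /esym/eqP xw; rewrite yw xw eqxx in nyx.
Qed.

(* Fix A in F.  For essential x, a member f x of F closest to A among those that
   differ from A at x has x as its only descent.  So f is injective from ess F to
   F :\ A, and bijective for cardinality reasons; hence every member but A has
   exactly one descent. *)
Lemma card_ess_edges F : F != set0 -> steppable F -> #|ess F| + 1 = #|F| ->
  #|F| = #|edges (one_inclusion F)| + 1.
Proof.
case/set0Pn=> A AF sF cardF.
have /fin_all_exists[f fP] x : exists B, x \in ess F ->
    B \in F :\ A /\ descents F A B = [set x].
  have [xE|_] := boolP (x \in ess F); last by exists A.
  have [B0 B0P] : exists B, [pred B | (B \in F) && (x \in symdiff A B)] B.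
    have [B [C [BF CF xBC]]] := essP _ _ xE.
    have [xAB|xAB] := boolP (x \in symdiff A B); first by exists B; rewrite /= BF.
    exists C; rewrite /= CF; move: xAB xBC; rewrite !in_symdiff.
    by do !case: (_ \in _).
  case: (arg_minnP (fun B => #|symdiff B A|) B0P) => B /andP[BF xAB] minB.
  exists B => _; have nBA : B != A.
    by apply: contraTneq xAB => ->; rewrite in_symdiff addbb.
  split; first by rewrite in_setD1 nBA.
  (* A descent [y] other than [x] would lead to a member closer to [A] that still differs from [A]
     at [x]. *)
  have dx y : y \in descents F A B -> y = x.
    rewrite in_descents => /andP[yAB yF]; apply/eqP/negPn/negP=> nyx.
    have := minB (toggle y B); rewrite /= yF in_symdiff in_toggle eq_sym (negbTE nyx).
    rewrite addbF -in_symdiff xAB => /(_ isT); apply/negP; rewrite -ltnNge.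
    by rewrite [ltnRHS](@card_symdiff_toggle y) // symdiffC.
  have nAB : A != B by rewrite eq_sym.
  have /card_gt0P[y yd] := descents_gt0 sF AF BF nAB.
  apply/setP=> z; rewrite in_set1; apply/idP/eqP => [/dx //|->].
  by rewrite -(dx y).
have f_inj : {in ess F &, injective f}.
  move=> x y /fP[_ dx] /fP[_ dy] exy.
  by apply/set1P; rewrite -dy -exy dx set11.
have imf : f @: ess F = F :\ A.
  apply/eqP; rewrite eqEcard card_in_imset //; apply/andP; split.
    by apply/subsetP=> _ /imsetP[x /fP[? _] ->].
  by rewrite -(leq_add2r 1) cardF (cardsD1 A) AF addnC.
rewrite (card_edges_setD1 F A) -imf big_imset //= (eq_bigr (fun=> 1)).
  by rewrite sum1_card cardF.
by move=> x /fP[_ ->]; rewrite cards1.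
Qed.

(** In a connected graph the labels are exactly [ess F], so equal cardinalities mean that the
    labelling is injective. *)
Lemma one_edge_per_labelE F : connected (one_inclusion F) ->
  one_edge_per_label F <-> #|edges (one_inclusion F)| = #|ess F|.
Proof.
move=> cF; rewrite -(elabel_edges cF); split=> [/distinct_labelsP dF|].
  by rewrite card_in_imset.
by move/esym/eqP/imset_injP => dF; apply/distinct_labelsP.
Qed.

(** * VC-dimension at most one and extremality *)

(** Traces on the pair are read relative to a base set [A], which merely permutes the four patterns;
    a base chosen in [F] realises the empty pattern at once. *)
Lemma vc_dim_le1P F :
  vc_dim F <= 1 <->
  (forall A x y, x != y ->
     ~ forall b c, exists S, [/\ S \in F, (x \in symdiff S A) = b
                             & (y \in symdiff S A) = c]).
Proof.
split=> [|noF].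
  move/bigmax_leqP=> vcF A x y nxy allF.
  have /vcF : shattered F [set x; y]; last by rewrite cards2 nxy.
  apply/eqP/setP=> Z; rewrite powersetE; apply/imsetP/idP => [[S _ ->]|sZ].
    exact: subsetIr.
  have [S [SF xS yS]] :=
    allF ((x \in Z) (+) (x \in A)) ((y \in Z) (+) (y \in A)).
  exists S => //; apply/setP=> z; rewrite in_setI !inE.
  move: xS yS; rewrite !in_symdiff => /addIb xS /addIb yS.
  have [->|nzx] := eqVneq z x; first by rewrite xS andbT.
  have [->|nzy] := eqVneq z y; first by rewrite yS andbT.
  rewrite andbF; apply: contraNF nzx => /(subsetP sZ).
  by rewrite !inE (negbTE nzy) orbF.
apply/bigmax_leqP=> Y /eqP shY; rewrite leqNgt; apply/negP.
case/card_gt1P=> x [y [xY yY nxy]]; apply: (noF set0 x y nxy) => b c.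
pose Z := [set z in Y | if z == x then b else c].
have: Z \in powerset Y by rewrite powersetE; apply/subsetP=> z; rewrite inE => /andP[].
rewrite -shY => /imsetP[S SF /setP eZ]; exists S; rewrite SF !in_symdiff !in_set0 !addbF.
by split=> //; [move: (eZ x) | move: (eZ y)];
  rewrite !inE ?xY ?yY ?eqxx 1?eq_sym ?(negbTE nxy) !andbT /= => ->.
Qed.

Lemma vc_dim_le1_one_edge F : vc_dim F <= 1 -> one_edge_per_label F.
Proof.
move/vc_dim_le1P=> vcF x S T SF S'F TF T'F exST; apply/eqP/negPn/negP.
rewrite -symdiff_eq0 => /set0Pn[y yST].
have nyx : y != x by apply: contraTneq yST => ->; rewrite in_symdiff exST addbb.
apply: (vcF S x y); first by rewrite eq_sym.
move=> b c; exists (let U := if c then T else S in if b then toggle x U else U).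
split.
- by case: b; case: c.
- by rewrite in_symdiff; case: b; case: c;
    rewrite ?in_toggle ?eqxx -?exST; case: (x \in S).
rewrite in_symdiff; move: yST; rewrite in_symdiff; case: b; case: c;
  by rewrite ?in_toggle ?(negbTE nyx) ?addbF ?addbb // addbC.
Qed.

Lemma one_edge_vc_dim_le1 F :
  steppable F -> one_edge_per_label F -> vc_dim F <= 1.
Proof.
move=> sF dF; apply/vc_dim_le1P => A x y nxy allF.
(* The chosen [S] and [T] agree at [y], so stepping from one to the other never toggles [y] and the
   edge found stays in the class [c]. *)
have edge c : exists S, [/\ S \in F, toggle x S \in F,
    x \notin symdiff S A & (y \in symdiff S A) = c].
  have [S [SF xS yS]] := allF false c; have [T [TF xT yT]] := allF true c.
  have xST : x \in symdiff S T.
    by move: xS xT; rewrite !in_symdiff; do !case: (_ \in _).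
  have [U [UF U'F xU agreeU]] := steppable_between sF SF TF xST.
  exists U; split=> //; first by rewrite in_symdiff xU -in_symdiff xS.
  rewrite in_symdiff agreeU -?in_symdiff // in_symdiff.
  by move: yS yT; rewrite !in_symdiff => <-; do !case: (_ \in _).
have [S [SF S'F xS yS]] := edge false; have [T [TF T'F xT yT]] := edge true.
move: yT; rewrite -(dF x S T) ?yS //.
by move: xS xT; rewrite !in_symdiff; do !case: (_ \in _).
Qed.

(** A shattered set is empty or a singleton [[set x]]. Any member serves for the former, and the
    lower end of an edge labelled [x] for the latter. *)
Lemma steppable_extremal F : F != set0 ->
  steppable F -> vc_dim F <= 1 -> extremal F.
Proof.
move=> F0 sF vcF Y shY.
have /leq_trans/(_ vcF) : #|Y| <= vc_dim F by apply: leq_bigmax_cond.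
rewrite leq_eqVlt ltnS leqn0 cards_eq0 => /orP[/cards1P[x eY]|/eqP eY]; last first.
  have [A AF] := set0Pn _ F0; apply/existsP; exists A; rewrite eY setC0 subsetT.
  by apply/subsetP=> _ /imsetP[Z + ->]; rewrite powersetE subset0 => /eqP->; rewrite set0U.
have tr b : exists2 S, S \in F & (x \in S) = b.
  have : (if b then [set x] else set0) \in powerset Y.
    by rewrite powersetE eY; case: b; rewrite ?sub0set.
  rewrite -(eqP shY) eY => /imsetP[S SF /setP/(_ x) eS].
  by exists S => //; move: eS; rewrite !inE eqxx andbT; case: b; rewrite !inE ?eqxx.
have [S SF xS] := tr false; have [T TF xT] := tr true.
have xST : x \in symdiff S T by rewrite in_symdiff xS xT.
have [U [UF U'F xU _]] := steppable_between sF SF TF xST.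
rewrite xS in xU; apply/existsP; exists U.
rewrite eY subsets_disjoint setCK disjoint_sym disjoints1 xU /=.
apply/subsetP=> _ /imsetP[Z + ->]; rewrite powersetE subset1.
case/orP=> /eqP->; last by rewrite set0U.
by rewrite -toggle_add ?xU.
Qed.

(** Strong shattering of [[set x]] is an edge labelled [x], exactly one endpoint of which agrees
    with [A] at [x]. *)
Lemma extremal_label F A B x : extremal F ->
    A \in F -> B \in F -> x \in symdiff A B ->
  exists S, [/\ S \in F, toggle x S \in F & x \notin symdiff S A].
Proof.
move=> eF AF BF xAB; have : shattered F [set x].
  apply/eqP/setP=> Z; rewrite powersetE; apply/imsetP/idP => [[S _ ->]|].
    exact: subsetIr.
  rewrite subset1 => eZ; exists (if (x \in A) == (x \in Z) then A else B).
    by case: ifP.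
  apply/setP=> y; rewrite in_setI in_set1.
  have [->|nyx] := eqVneq y x; last first.
    by rewrite andbF; case/orP: eZ => /eqP->; rewrite inE ?(negbTE nyx).
  by move: xAB; rewrite in_symdiff andbT; case: ifP => [/eqP-> //|];
    do !case: (_ \in _).
case/eF/existsP=> S /andP[SY /subsetP sF].
have xS : x \notin S.
  by apply/negP=> xS; move/subsetP/(_ x xS): SY; rewrite !inE eqxx.
have SF : S \in F.
  by apply: sF; apply/imsetP; exists set0; rewrite ?set0U // powersetE sub0set.
have S'F : toggle x S \in F.
  by rewrite toggle_add //; apply: sF; apply/imsetP; exists [set x];
    rewrite // powersetE.
have [xA|xA] := boolP (x \in A); last first.
  by exists S; rewrite in_symdiff (negbTE xS) (negbTE xA).
by exists (toggle x S); rewrite toggleK in_symdiff in_toggle (negbTE xS) eqxx xA.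
Qed.

(* Measured from A, each x where A and B differ labels an edge {S, toggle x S} of
   F, and dimension one orders these x linearly (y below x if every member that
   contains x contains y).  The edge whose S has the smallest trace on
   symdiff A B belongs to the least x, and its S is A itself. *)
Lemma extremal_steppable F : extremal F -> vc_dim F <= 1 -> steppable F.
Proof.
move=> eF /vc_dim_le1P vcF A B AF BF; rewrite -symdiff_eq0 => /set0Pn[x0 x0D].
(* The digits in the names are the values at [x] and [y] relative to [A]. *)
have no4 x y S00 S01 S10 S11 : x != y ->
    [&& S00 \in F, x \notin symdiff S00 A & y \notin symdiff S00 A] ->
    [&& S01 \in F, x \notin symdiff S01 A & y \in symdiff S01 A] ->
    [&& S10 \in F, x \in symdiff S10 A & y \notin symdiff S10 A] ->
    [&& S11 \in F, x \in symdiff S11 A & y \in symdiff S11 A] -> False.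
  move=> nxy /and3P[? /negbTE ? /negbTE ?] /and3P[? /negbTE ? ?].
  move=> /and3P[? ? /negbTE ?] /and3P[? ? ?].
  apply: (vcF A x y nxy) => -[] [].
  - by exists S11.
  - by exists S10.
  - by exists S01.
  - by exists S00.
have noA x : x \notin symdiff A A by rewrite in_symdiff addbb.
set D := symdiff A B in x0D *; have eD : symdiff B A = D by rewrite symdiffC.
pose P (u : X * {set X}) := [&& u.1 \in D, u.2 \in F, toggle u.1 u.2 \in F
                              & u.1 \notin symdiff u.2 A].
have PE x : x \in D -> exists S, P (x, S).
  by move=> xD; have [S [SF TF xS]] := extremal_label eF AF BF xD; exists S; apply/and4P.
have [S0 P0] := PE _ x0D.
case: (arg_minnP (fun u : X * {set X} => #|symdiff u.2 A :&: D|) P0) => -[x S].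
case/and4P=> /= xD SF TF xS minS.
(* Otherwise the edge [T] found for [y] has a strictly smaller trace on [D]: an extra [z] in its
   trace would let [A], [T], [S], [B] realise all four patterns on [y] and [z]. *)
have SD y : y \in D -> y \notin symdiff S A.
  move=> yD; apply/negP=> yS; have [T PT] := PE _ yD.
  have := minS _ PT; case/and4P: PT => /= _ T0F _ yT.
  apply/negP; rewrite -ltnNge; apply: proper_card; apply/properP; split; last first.
    by exists y; rewrite in_setI ?yS // negb_and yT.
  apply/subsetP=> z; rewrite !in_setI => /andP[zT zD]; rewrite zD andbT.
  apply/negPn/negP=> zS.
  have nyz : y != z by apply: contraNneq yT => ->.
  by apply: (no4 y z A T S B nyz); rewrite ?AF ?T0F ?SF ?BF ?eD ?noA ?yT ?zT ?yS ?zS ?yD ?zD.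
(* A difference [z] outside [D] would be shattered together with [x] by [A], [S], [B] and
   [toggle x S]. *)
have SA : S = A.
  apply/eqP; rewrite -symdiff_eq0; apply/set0Pn=> -[z zS].
  have zD : z \notin D by apply: contraL zS => /SD.
  have nxz : x != z by apply: contraNneq xS => ->.
  apply: (no4 x z A S B (toggle x S) nxz);
    rewrite ?AF ?SF ?BF ?TF ?eD ?noA ?xS ?zS ?xD ?zD //.
  rewrite !in_symdiff !in_toggle eqxx eq_sym (negbTE nxz) addbF -in_symdiff zS.
  by rewrite addbT addNb -in_symdiff xS.
by exists x => //; rewrite -SA.
Qed.

(** * Invariance under flips *)

Lemma mem_flip F A S : (S \in flip F A) = (symdiff S A \in F).
Proof.
rewrite flipE; apply/imsetP/idP => [[T TF ->]|SF]; first by rewrite symdiffK.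
by exists (symdiff S A); rewrite ?symdiffK.
Qed.

Lemma toggle_symdiff x S A : toggle x (symdiff S A) = symdiff (toggle x S) A.
Proof. by apply/setP=> y; rewrite !(in_toggle, in_symdiff) addbAC. Qed.

Lemma flipK F A : flip (flip F A) A = F.
Proof. by apply/setP=> S; rewrite !mem_flip symdiffK. Qed.

Lemma steppable_flip F A : steppable F -> steppable (flip F A).
Proof.
move=> sF S T; rewrite !mem_flip => SF TF nST.
have [|x xST xF] := sF _ _ SF TF; first by rewrite (can_eq (symdiffK A)).
exists x; last by rewrite mem_flip -toggle_symdiff.
by move: xST; rewrite !in_symdiff; do !case: (_ \in _).
Qed.

Lemma one_edge_per_label_flip F A :
  one_edge_per_label F -> one_edge_per_label (flip F A).
Proof.
move=> dF x S T; rewrite !mem_flip -!toggle_symdiff => SF S'F TF T'F exST.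
by apply: (can_inj (symdiffK A)); apply: (dF x) => //; rewrite !in_symdiff exST.
Qed.

(** Well-gradedness makes the distance from [set0] equal to the cardinality, and each edge adds one
    element. *)
Lemma steppable_uniformly_directed F : set0 \in F ->
  steppable F -> one_edge_per_label F ->
  uniformly_directed_tree (one_inclusion F) set0.
Proof.
move=> F0 sF dF; have wF := (well_gradedP F).2 sF.
split=> //; first by split; [apply: well_graded_connected|apply: one_edge_per_label_acyclic].
move=> S T x; rewrite edgesE => /and4P[SF TF xS /eqP eT].
exists #|symdiff set0 S|, #|symdiff set0 T|; rewrite !wF //; split=> //.
by rewrite !(symdiffC set0) eT -toggle_add // card_symdiff_toggleN // in_symdiff inE addbF.
Qed.

End OneInclusion.

Theorem theorem3p7 (X : finType) (F : {set {set X}}) (F_neq0 : F != set0) :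
  [<-> (* 1 *) well_graded F /\ vc_dim F <= 1;
       (* 2 *) extremal F /\ vc_dim F <= 1;
       (* 3 *) [/\ connected (one_inclusion F), #|ess F| + 1 = #|F|
                 & #|F| = #|edges (one_inclusion F)| + 1];
       (* 4 *) well_graded F /\ #|F| = #|edges (one_inclusion F)| + 1;
       (* 5 *) well_graded F /\ additionality F = 1%R;
       (* 5, second form *) well_graded F /\ #|ess F| + 1 = #|F|;
       (* 6 *) is_tree (one_inclusion F) /\ distinct_labels (one_inclusion F);
       (* 7 *) [/\ is_tree (one_inclusion F),
                   #|vertices (one_inclusion F)| = #|ess F| + 1,
                   #|edges (one_inclusion F)| = #|ess F|,
                   {in edges (one_inclusion F), forall e, elabel e \in ess F}
                 & {in ess F, forall x,
                     #|[set e in edges (one_inclusion F) | elabel e == x]| = 1}];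
       (* 8 *) forall A, A \in F ->
                 uniformly_directed_tree (one_inclusion (flip F A)) set0
                 /\ distinct_labels (one_inclusion (flip F A));
       (* 9 *) exists2 A, A \in F &
                 uniformly_directed_tree (one_inclusion (flip F A)) set0
                 /\ distinct_labels (one_inclusion (flip F A))].
Proof.
set G := one_inclusion F.
have CD (H : {set {set X}}) : connected (one_inclusion H) ->
    distinct_labels (one_inclusion H) -> steppable H /\ one_edge_per_label H.
  by move=> cH /distinct_labelsP dH; split=> //; apply: connected_steppable.
have D1 : connected G -> #|edges G| = #|ess F| -> steppable F /\ one_edge_per_label F.
  move=> cF cardE; apply: CD => //; apply/distinct_labelsP.
  exact/one_edge_per_labelE.
have conn : steppable F -> connected G.
  by move/well_gradedP/well_graded_connected.
have treeF : steppable F /\ one_edge_per_label F -> is_tree G.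
  by case=> sF dF; split; [apply: conn | apply: one_edge_per_label_acyclic].
have cardE : steppable F /\ one_edge_per_label F -> #|edges G| = #|ess F|.
  by case=> sF dF; apply/one_edge_per_labelE => //; apply: conn.
have cardF : steppable F /\ one_edge_per_label F -> #|F| = #|edges G| + 1.
  by case=> sF dF; apply: one_edge_per_label_card.
have E4 : well_graded F /\ #|F| = #|edges G| + 1 ->
    steppable F /\ one_edge_per_label F.
  by case=> /well_gradedP sF cF; split=> //; apply: card_one_edge_per_label.
tfae.
- case=> /well_gradedP sF vF; split=> //; exact: steppable_extremal.
- case=> eF vF; have sF := extremal_steppable eF vF.
  have dF := vc_dim_le1_one_edge vF.
  by split; [exact: conn | rewrite -cardE ?cardF | exact: cardF].
- case=> cF c1 c2; have [||sF dF] := D1 => //.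
    by apply/eqP; rewrite -(eqn_add2r 1) -c2 c1.
  by split=> //; apply/well_gradedP.
- move=> h; have [sF dF] := E4 h; case: h => wF cF; split=> //.
  by rewrite /additionality cF cardE // PoszD GRing.addrAC GRing.subrr GRing.add0r.
- case=> wF /eqP; rewrite /additionality GRing.subr_eq => /eqP aF; split=> //.
  by case: aF => ->; rewrite addnC.
- case=> wF cF; have /E4 h : well_graded F /\ #|F| = #|edges G| + 1.
    by split=> //; apply: card_ess_edges => //; apply/well_gradedP.
  by split; [exact: treeF | case: h => _ /distinct_labelsP].
- case=> -[cF aF] dF; have h := CD F cF dF.
  split=> //; [by rewrite -cardE ?cardF | exact: cardE | exact: elabel_ess | ].
  move=> x; rewrite -(elabel_edges cF) => /imsetP[e eE ->]; apply/eqP/cards1P.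
  exists e; apply/setP=> e'; rewrite in_set1.
  by apply/setIdP/eqP => [[e'E /eqP/dF-> //]|->].
- case=> -[cF _] _ _ lE l1 A AF; have [|sF dF] := CD F cF.
    move=> e e' eE e'E ee'; have /eqP/cards1P[e0 E0] := l1 _ (lE _ eE).
    have /set1P-> : e \in [set e0] by rewrite -E0; apply/setIdP.
    by apply/esym/set1P; rewrite -E0; apply/setIdP; rewrite ee'.
  have dF' := one_edge_per_label_flip (A := A) dF.
  split; last exact/distinct_labelsP.
  apply: steppable_uniformly_directed => //; last exact: steppable_flip.
  by rewrite mem_flip; suff -> : symdiff set0 A = A by []; apply/setP=> x; rewrite in_symdiff inE.
- by move=> h8; have [A AF] := set0Pn _ F_neq0; exists A => //; apply: h8.
case=> A AF [[[cF' _] _ _] dF']; have [sF' {}dF'] := CD _ cF' dF'.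
(* The flip at [A] is an involution, so both properties pass back from the flipped family to [F]. *)
have sF := steppable_flip (A := A) sF'.
have dF := one_edge_per_label_flip (A := A) dF'.
rewrite flipK in sF dF; split; first exact/well_gradedP.
exact: one_edge_vc_dim_le1.
Qed.
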